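(* Let $\mathbb{F}_q$ be a finite field and $1\le r\le q-1$. Consider $(k,D)$-regular instances of $\text{max-E}k\text{-LINSAT}(q,r)$ with $m$ constraints and $n$ variables, so that $n/m=k/D$. Let $p=\ell/m\in[0,1-1/q]$ be a normalized decoding radius satisfying the quantum (Holevo) rate condition $$\Bigl(1-\frac{n}{m}\Bigr)\log_2 q\;\le\;\chi_q(p).$$ Then, for fixed $k$ and $D\to\infty$, the approximation ratio $\alpha_{\mathrm{DQI}}(p)$ of decoded quantum interferometry with a quantum decoder satisfies $$\alpha_{\mathrm{DQI}}(p)\;\le\;\frac rq+\mathcal{O}_{q,r}\!\left(\frac{1}{\sqrt{D}}\right).$$
   Context: An instance of $\text{max-E}k\text{-LINSAT}(q,r)$ consists of a matrix $B\in\mathbb{F}_q^{m\times n}$ with exactly $k$ nonzero entries in each row and sets $F_i\subset\mathbb{F}_q$ with $|F_i|=r$; constraint $i$ is $\sum_j B_{i,j}x_j\in F_i$. It is $(k,D)$-regular if moreover each column of $B$ has exactly $D$ nonzero entries, so $km=Dn$. The dual code $C^\perp=\ker(B^T)\subseteq\mathbb{F}_q^m$ has rate $1-\operatorname{rank}(B)/m\ge 1-n/m$. Decoded quantum interferometry (DQI) uses a decoder for $C^\perp$; $\ell$ denotes its asymptotic decoding radius, i.e. the maximum number of random errors in $C^\perp$ that the decoder can reliably correct. The approximation ratio of DQI (fraction of satisfied constraints) is taken to be given by the semicircle law: with $p=\ell/m$, $$\alpha_{\mathrm{DQI}}(p)=\left(\sqrt{p\Bigl(1-\frac rq\Bigr)}+\sqrt{\frac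 rq(1-p)}\right)^{2}\ \text{ if } \frac rq\le 1-p,\qquad \alpha_{\mathrm{DQI}}(p)=1\ \text{ otherwise.}$$ For a quantum decoder the coherent errors are modelled by the classical-quantum channel sending each symbol $i\in\mathbb{F}_q$ to the pure state $$|i_p\rangle=\sqrt{1-p}\,|i\rangle+\sqrt{\tfrac{p}{q-1}}\sum_{j\ne i}|j\rangle\in\mathbb{C}^q,$$ where $\{|i\rangle\}_{i\in\mathbb{F}_q}$ is an orthonormal basis of $\mathbb{C}^q$. Its Holevo capacity (in bits) is $\chi_q(p)=S(\bar\rho)=-\operatorname{Tr}(\bar\rho\log_2\bar\rho)$ with $\bar\rho=\frac1q\sum_{i\in\mathbb{F}_q}|i_p\rangle\langle i_p|$. Reliable decoding requires the code rate (in bits per symbol) not to exceed this capacity, which gives the rate condition in the claim. *)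

(* Defs.v *)
From HB Require Import structures.
From mathcomp Require Import all_boot all_order all_algebra.
From mathcomp Require Import complex.
From mathcomp Require Import all_classical all_reals all_analysis.

Set Implicit Arguments.
Unset Strict Implicit.
Unset Printing Implicit Defensive.

Import Order.TTheory GRing.Theory Num.Theory.
Import numFieldNormedType.Exports.
Local Open Scope ring_scope.
Local Open Scope complex_scope.
Local Open Scope sesquilinear_scope.

(* Constraint i asks that \sum_j linsat_mx i j * x j lie in linsat_set i. *)
Record linsat (F : finFieldType) (k r m n : nat) := Linsat {
  linsat_mx : 'M[F]_(m, n);
  linsat_set : 'I_m -> {set F};
  linsat_row : forall i, #|[pred j | linsat_mx i j != 0]| = k;
  linsat_card : forall i, #|linsat_set i| = r }.

Definition linsat_regular (F : finFieldType) (k r m n D : nat)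
    (I : linsat F k r m n) : Prop :=
  forall j, #|[pred i | linsat_mx I i j != 0]| = D.

Definition alpha_DQI (R : realType) (q r : nat) (p : R) : R :=
  if r%:R / q%:R <= 1 - p then
    (Num.sqrt (p * (1 - r%:R / q%:R)) + Num.sqrt (r%:R / q%:R * (1 - p))) ^+ 2
  else 1.

Definition log2 (R : realType) (x : R) : R := ln x / ln 2.

(* g (A) for a Hermitian A, whose eigenvalues are real: g is applied to the
   eigenvalues in an orthonormal eigenbasis, see [orthomx_spectralP]. *)
Definition mxfun (R : realType) (d : nat) (g : R -> R) (A : 'M[R[i]]_d)
    : 'M[R[i]]_d :=
  invmx (spectralmx A)
    *m diag_mx (map_mx (fun z => (g (complex.Re z))%:C) (spectral_diag A))
    *m spectralmx A.

(* [ln 0 = 0], which gives the usual convention 0 log 0 = 0. *)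
Definition vonNeumann_entropy (R : realType) (d : nat) (rho : 'M[R[i]]_d) : R :=
  - complex.Re (\tr (rho *m mxfun (@log2 R) rho)).

Section Channel.
Variables (R : realType) (F : finFieldType).

(* C^q, with q = #|F|, has its standard basis indexed by F via [enum_rank]. *)
Definition basis_ket (i : F) : 'cV[R[i]]_#|F| := delta_mx (enum_rank i) 0.

Definition channel_ket (p : R) (i : F) : 'cV[R[i]]_#|F| :=
  (Num.sqrt (1 - p))%:C *: basis_ket i
  + (Num.sqrt (p / (#|F|%:R - 1)))%:C *: \sum_(j | j != i) basis_ket j.

Definition channel_avg (p : R) : 'M[R[i]]_#|F| :=
  (#|F|%:R)^-1 *: \sum_(i : F) channel_ket p i *m (channel_ket p i)^t*.

Definition holevo (p : R) : R := vonNeumann_entropy (channel_avg p).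

End Channel.

(* Main.v *)
(** If the rate is at least 1 - k/D, the Holevo capacity forces the entropy of
the average state rho to be within (k/D) log q of its maximum log q. The
entropy deficit dominates the squared L2 distance of the spectrum to the
uniform one, i.e. (Tr rho^2 - 1/q)/4. The overlaps of distinct signal states
are at least 2 sqrt(p(1-p)/(q-1)), so Tr rho^2 - 1/q >= 4p(1-p)/q, hence
p = O(1/D). Since alpha_DQI(p) - r/q = O(sqrt p), the bound follows. *)
Require Import Defs.
From mathcomp Require Import all_boot all_order all_algebra.
From mathcomp Require Import complex.
From mathcomp Require Import all_classical all_reals all_analysis.
From mathcomp Require Import ring lra.

Import Order.TTheory GRing.Theory Num.Theory.
Import numFieldNormedType.Exports.
Local Open Scope ring_scope.

(** * Scalar inequalities: entropy deficit against collision probability *)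

Lemma ln_ge_oneBV (R : realType) (x : R) : 0 < x -> 1 - x^-1 <= ln x.
Proof.
move=> x0; rewrite -[x in ln x]invrK lnV ?posrE ?invr_gt0//.
have xV0 : 0 < x^-1 by rewrite invr_gt0.
have := @le_ln1Dx R (x^-1 - 1); rewrite addrCA subrr addr0.
by move=> /(_ ltac:(lra)); lra.
Qed.

(** With t = sqrt x, the bound ln t >= 1 - 1/t gives x ln x >= 2 t (t - 1) = x - 1 + (t - 1)^2.
    Moreover (x - 1)^2 = (t - 1)^2 (t + 1)^2, where (t + 1)^2 <= 2 (x + 1) <= 4 M. *)
Lemma xlnx_ge_quadratic (R : realType) (M x : R) : 1 <= M -> 0 <= x <= M ->
  x - 1 + (x - 1) ^+ 2 / (4 * M) <= x * ln x.
Proof.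
move=> M1 /andP[x0 xM].
have tM : (Num.sqrt x + 1) ^+ 2 <= 4 * M.
  have := sqr_sqrtr x0; set t := Num.sqrt x => xE.
  by have := sqr_ge0 (t - 1); nra.
have sq : (x - 1) ^+ 2 / (4 * M) <= (Num.sqrt x - 1) ^+ 2.
  rewrite ler_pdivrMr; last by lra.
  rewrite -{1}(sqr_sqrtr x0) -[1 in X in X <= _](expr1n _ 2) subr_sqr exprMn.
  by rewrite ler_wpM2l ?sqr_ge0// sqr_ge0.
have := sqr_sqrtr x0; set t := Num.sqrt x in tM sq * => xE.
move: (x0); rewrite le_eqVlt => /predU1P[x_eq0|xgt0].
  have -> : x * ln x = 0 by rewrite -x_eq0 mul0r.
  have t0 : t = 0 by rewrite /t -x_eq0 sqrtr0.
  by move: sq; rewrite t0 -x_eq0; set s := _ / _; lra.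
have t0 : 0 < t by rewrite sqrtr_gt0.
have lnt : 2 * (t - 1) * t <= x * ln x.
  have -> : ln x = 2 * ln t by rewrite -{1}xE lnXn// mulr_natl.
  have := ln_ge_oneBV _ _ t0; rewrite -(ler_pM2l xgt0) => lt.
  have -> : 2 * (t - 1) * t = 2 * (x * (1 - t^-1)).
    by rewrite -xE; field; rewrite gt_eqF.
  by rewrite [x * (2 * _)]mulrCA ler_wpM2l.
by move: sq lnt; rewrite -[X in X - 1 + _ <= _]xE; set s := _ / _; lra.
Qed.

(* A Pinsker-type bound, with the L2 distance to the uniform distribution. *)
Lemma entropy_le_collision (R : realType) (d : nat) (x : 'I_d -> R) :
  (forall i, 0 <= x i) -> \sum_i x i = 1 ->
  - (\sum_i x i * ln (x i)) <= ln d%:R - (\sum_i x i ^+ 2 - d%:R^-1) / 4.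
Proof.
move=> x0 x1.
have d0 : (0 < d)%N.
  by case: d x x0 x1 => // x _; rewrite big_ord0 => /esym/eqP; rewrite oner_eq0.
have dR : 0 < d%:R :> R by rewrite ltr0n.
have d1 : 1 <= d%:R :> R by rewrite ler1n.
have xle1 i : x i <= 1.
  by rewrite -x1 (bigD1 i)//= lerDl sumr_ge0.
(* This is the quadratic bound at [d * x i], divided by d; M = d is allowed because [x i <= 1]. On
   summation the terms [x i - 1/d] cancel, the weights adding up to 1. *)
have bnd i : x i - d%:R^-1 + (x i ^+ 2 - 2 * x i / d%:R + d%:R^-1 * d%:R^-1) / 4
    <= x i * ln d%:R + x i * ln (x i).
  have := @xlnx_ge_quadratic R d%:R (d%:R * x i) d1.
  rewrite mulr_ge0 ?(ltW dR)//= ger_pMr// xle1 => /(_ isT).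
  have -> : d%:R * x i * ln (d%:R * x i)
            = d%:R * (x i * ln d%:R + x i * ln (x i)).
    move: (x0 i); rewrite le_eqVlt => /predU1P[<-|xi0].
      by rewrite !(mul0r, mulr0) addr0 mulr0.
    by rewrite lnM ?posrE// mulrDr mulrDr !mulrA.
  move=> xln; rewrite -(ler_pM2l dR); apply: le_trans xln.
  by rewrite le_eqVlt; apply/orP; left; apply/eqP; field; rewrite gt_eqF.
have := @ler_sum R _ (index_enum 'I_d) xpredT _ _ (fun i _ => bnd i).
rewrite !big_split/= -!mulr_suml x1 mul1r !big_split/= -mulr_suml !sumrN.
rewrite !sumr_const card_ord -mulr_suml -mulr_sumr x1.
rewrite -[_ *+ d]mulr_natr mulVf ?gt_eqF//; lra.
Qed.

(** * Spectra of nonnegative combinations of rank-one projectors *)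

Section Spectral.
Local Open Scope complex_scope.
Local Open Scope sesquilinear_scope.

Lemma mxtrace_conj_diag (K : comUnitRingType) (d : nat) (U : 'M[K]_d)
    (v : 'rV[K]_d) : U \in unitmx ->
  \tr (invmx U *m diag_mx v *m U) = \sum_i v 0 i.
Proof. by move=> Uu; rewrite mxtrace_mulC mulmxA mulmxV// mul1mx mxtrace_diag. Qed.

Lemma mulmx_conj_diag (K : comUnitRingType) (d : nat) (U : 'M[K]_d)
    (v w : 'rV[K]_d) : U \in unitmx ->
  (invmx U *m diag_mx v *m U) *m (invmx U *m diag_mx w *m U)
  = invmx U *m diag_mx (\row_i (v 0 i * w 0 i)) *m U.
Proof.
by move=> Uu; rewrite !mulmxA mulmxK// -[_ *m diag_mx v *m _]mulmxA mulmx_diag.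
Qed.

Lemma trmxCM (C : numClosedFieldType) (m n p : nat) (A : 'M[C]_(m, n))
  (B : 'M[C]_(n, p)) : (A *m B)^t* = B^t* *m A^t*.
Proof. by rewrite trmx_mul map_mxM. Qed.

Lemma trmxCK (C : numClosedFieldType) (m n : nat) (A : 'M[C]_(m, n)) :
  (A^t*)^t* = A.
Proof. by apply/matrixP => i j; rewrite !mxE conjCK. Qed.

Lemma mulmx_trmxC_diag_ge0 (C : numClosedFieldType) (m n : nat)
  (A : 'M[C]_(m, n)) (i : 'I_m) : 0 <= (A *m A^t*) i i.
Proof. by rewrite mxE sumr_ge0// => j _; rewrite !mxE mul_conjC_ge0. Qed.

Lemma gram_hermsymmx (R : realType) (I : finType) (d : nat) (c : R)
    (v : I -> 'cV[R[i]]_d) :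
  c%:C *: (\sum_i v i *m (v i)^t*) \is hermsymmx.
Proof.
apply/is_hermitianmxP; rewrite scale1r; apply/matrixP => x y.
rewrite !mxE rmorphM [X in _ = X * _]conjc_real !summxE rmorph_sum; congr (_ * _).
by apply: eq_bigr => i _; rewrite -{1}[v i *m _]trmxCK trmxCM trmxCK !mxE.
Qed.

(** In the unitary eigenbasis U, an eigenvalue is a diagonal entry of the conjugated matrix, that
    is, c times a sum of squared moduli of entries of the vectors U v_k. *)
Lemma gram_spectral_diag_ge0 (R : realType) (I : finType) (d : nat) (c : R)
    (v : I -> 'cV[R[i]]_d) (i : 'I_d) : 0 <= c ->
  0 <= spectral_diag (c%:C *: (\sum_i v i *m (v i)^t*)) 0 i.
Proof.
move=> c0; set A := _ *: _; set U := spectralmx A.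
have Uu : U \in unitmx by exact: spectral_unit.
have -> : spectral_diag A 0 i = (U *m A *m U^t*) i i.
  have /hermitian_normalmx/orthomx_spectralP/= AE : A \is hermsymmx.
    exact: gram_hermsymmx.
  rewrite [in RHS]AE -/U -invmx_unitary ?spectral_unitarymx//.
  by rewrite !mulmxA mulmxV// mul1mx mulmxK// mxE eqxx mulr1n.
rewrite /A -scalemxAr -scalemxAl mxE mulr_ge0 ?ler0c//.
rewrite mulmx_sumr mulmx_suml summxE sumr_ge0// => k _.
have -> : U *m (v k *m (v k)^t*) *m U^t* = U *m v k *m (U *m v k)^t*.
  by rewrite trmxCM !mulmxA.
exact: mulmx_trmxC_diag_ge0.
Qed.

(** A, its square and A log A are diagonal in one eigenbasis, so trace, purity and entropy all
    become sums over a single real family, to which the scalar entropy inequality applies. *)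
Lemma gram_spectrum (R : realType) (I : finType) (d : nat) (c : R)
    (v : I -> 'cV[R[i]]_d) : 0 <= c ->
  let A := c%:C *: (\sum_i v i *m (v i)^t*) in
  exists2 x : 'I_d -> R, (forall i, 0 <= x i)
  & [/\ \tr A = (\sum_i x i)%:C, \tr (A *m A) = (\sum_i x i ^+ 2)%:C
      & vonNeumann_entropy A = - \sum_i x i * log2 (x i)].
Proof.
move=> c0 A; pose x i := complex.Re (spectral_diag A 0 i).
have Uu : spectralmx A \in unitmx by exact: spectral_unit.
have /hermitian_normalmx/orthomx_spectralP/= AE : A \is hermsymmx.
  exact: gram_hermsymmx.
(* In the order on complex numbers, being nonnegative includes being real. *)
have xE i : spectral_diag A 0 i = (x i)%:C.
  by rewrite RRe_real// ger0_real// gram_spectral_diag_ge0.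
have x0 i : 0 <= x i by rewrite -ler0c -xE gram_spectral_diag_ge0.
exists x => //; split.
- rewrite AE mxtrace_conj_diag// rmorph_sum/=.
  by apply: eq_bigr => i _; rewrite xE.
- rewrite [X in X *m _]AE [X in _ *m X]AE mulmx_conj_diag// mxtrace_conj_diag//.
  by rewrite rmorph_sum/=; apply: eq_bigr => i _; rewrite mxE xE -rmorphM.
- rewrite /vonNeumann_entropy [X in X *m _]AE /mxfun mulmx_conj_diag//.
  rewrite mxtrace_conj_diag//.
  suff -> : \sum_i (\row_j (spectral_diag A 0 j *
      map_mx (fun z => (log2 (complex.Re z))%:C) (spectral_diag A) 0 j)) 0 i
      = (\sum_i x i * log2 (x i))%:C by [].
  by rewrite rmorph_sum; apply: eq_bigr => i _; rewrite !mxE xE [RHS]rmorphM.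
Qed.

End Spectral.

(** * The average state of the channel and its purity *)

Section Channel.
Local Open Scope complex_scope.
Local Open Scope sesquilinear_scope.
Variables (R : realType) (F : finFieldType).
Local Notation q := (#|F|%:R : R).

(** The coordinate at j of the signal state of i, kept real and indexed by the field itself. *)
Definition amplitude (p : R) (i j : F) : R :=
  if j == i then Num.sqrt (1 - p) else Num.sqrt (p / (q - 1)).

(** This is q times an entry of the average state. As [amplitude] is symmetric in its field
    arguments, it is also the inner product of two signal states. *)
Definition overlap (p : R) (x y : F) : R :=
  \sum_i amplitude p i x * amplitude p i y.

Lemma channel_ketE (p : R) (i : F) (x : 'I_#|F|) :
  channel_ket p i x 0 = (amplitude p i (enum_val x))%:C.
Proof.
rewrite !mxE summxE /amplitude.
under eq_bigr do rewrite mxE andbT.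
rewrite -(can_eq (@enum_rankK F)) enum_valK andbT.
have [->|xi] := eqVneq x (enum_rank i).
  rewrite mulr1 big1 ?mulr0 ?addr0// => j ji.
  by rewrite (inj_eq enum_rank_inj) eq_sym (negbTE ji).
rewrite mulr0 add0r (bigD1 (enum_val x))/=; last first.
  by apply: contraNneq xi => <-; rewrite enum_valK.
rewrite enum_valK eqxx big1 ?addr0 ?mulr1// => j /andP[_ jx].
by rewrite -[x in x == _]enum_valK (inj_eq enum_rank_inj) eq_sym (negbTE jx).
Qed.

Lemma channel_avgE (p : R) :
  channel_avg F p = \matrix_(x, y) (q^-1 * overlap p (enum_val x) (enum_val y))%:C.
Proof.
apply/matrixP => x y; rewrite !mxE summxE rmorphM fmorphV rmorph_nat; congr (_ * _).
rewrite rmorph_sum; apply: eq_bigr => i _.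
rewrite mxE big_ord1 [_^t* _ _]mxE [_^T _ _]mxE.
by rewrite !channel_ketE rmorphM/= [X in _ * X]conjc_real.
Qed.

Lemma card_field_gt1 : 1 < q.
Proof. by rewrite ltr1n card_finNzRing_gt1. Qed.

Lemma overlap_diag (p : R) (x : F) : 0 <= p <= 1 -> overlap p x x = 1.
Proof.
move=> /andP[p0 p1]; have q1 := card_field_gt1.
rewrite /overlap (bigD1 x)//= /amplitude eqxx -expr2 sqr_sqrtr; last by lra.
under eq_bigr => i ix.
  rewrite eq_sym (negbTE ix) -expr2 sqr_sqrtr; last first.
    by rewrite divr_ge0//; lra.
  over.
rewrite sumr_const cardC1 -[_ *+ _.-1]mulr_natr -subn1.
rewrite natrB; last exact: ltnW (card_finNzRing_gt1 F).
by rewrite divfK ?subrK//; lra.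
Qed.

Lemma overlapC (p : R) (x y : F) : overlap p x y = overlap p y x.
Proof. by apply: eq_bigr => i _; rewrite mulrC. Qed.

(** The bound keeps only the terms i = x and i = y, which are equal; the others are products of
    square roots, hence nonnegative. *)
Lemma overlap_ge (p : R) (x y : F) : x != y ->
  2 * (Num.sqrt (1 - p) * Num.sqrt (p / (q - 1))) <= overlap p x y.
Proof.
move=> xy; rewrite /overlap (bigD1 x)//= (bigD1 y) 1?eq_sym//= /amplitude.
rewrite !eqxx [y == x]eq_sym (negbTE xy) addrA.
have : 0 <= \sum_(i | (i != x) && (i != y))
    (if x == i then Num.sqrt (1 - p) else Num.sqrt (p / (q - 1))) *
    (if y == i then Num.sqrt (1 - p) else Num.sqrt (p / (q - 1))).
  by apply: sumr_ge0 => i _; rewrite mulr_ge0//; case: ifP; rewrite sqrtr_ge0.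
lra.
Qed.

Lemma mxtrace_channel_avg (p : R) : 0 <= p <= 1 -> \tr (channel_avg F p) = 1.
Proof.
move=> p01; rewrite channel_avgE /mxtrace.
under eq_bigr do rewrite mxE overlap_diag// mulr1.
rewrite sumr_const card_ord -[_%:C *+ _]mulr_natr fmorphV rmorph_nat mulVf//.
by rewrite pnatr_eq0 -lt0n ltnW// card_finNzRing_gt1.
Qed.

(** Each of the q rows contributes 1/q^2 from the diagonal and at least e/q^2 from each of its q - 1
    other entries, with e the squared lower bound on overlaps. The trace is complex, hence the real
    witness t. *)
Lemma purity_channel_avg (p : R) : 0 <= p <= 1 ->
  exists2 t : R, \tr (channel_avg F p *m channel_avg F p) = t%:C
  & q^-1 + 4 * (p * (1 - p)) / q <= t.
Proof.
move=> p01; have q1 := card_field_gt1.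
exists (\sum_(x : 'I_#|F|) \sum_(y : 'I_#|F|)
    (q^-1 * overlap p (enum_val x) (enum_val y)) ^+ 2).
  rewrite channel_avgE /mxtrace rmorph_sum; apply: eq_bigr => x _.
  rewrite mxE rmorph_sum; apply: eq_bigr => y _.
  by rewrite !mxE -rmorphM expr2 [overlap p (enum_val y) _]overlapC.
pose e : R := (2 * (Num.sqrt (1 - p) * Num.sqrt (p / (q - 1)))) ^+ 2.
(* The denominator q - 1 cancels against the number of off-diagonal entries in a row. *)
have eE : e = 4 * (p * (1 - p)) / (q - 1).
  case/andP: p01 => p0 p1.
  rewrite /e 2!exprMn !sqr_sqrtr; [|by rewrite divr_ge0//; lra|by lra].
  by field; lra.
have row_ge (x : 'I_#|F|) : q^-1 ^+ 2 * (1 + (q - 1) * e) <=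
    \sum_(y : 'I_#|F|) (q^-1 * overlap p (enum_val x) (enum_val y)) ^+ 2.
  rewrite (bigD1 x)//= overlap_diag// mulr1 mulrDr mulr1 lerD2l.
  have -> : q^-1 ^+ 2 * ((q - 1) * e)
      = \sum_(y : 'I_#|F| | y != x) q^-1 ^+ 2 * e.
    rewrite sumr_const cardC1 card_ord -[_ *+ _.-1]mulr_natl -subn1.
    rewrite natrB; first by rewrite mulrCA.
    exact: ltnW (card_finNzRing_gt1 F).
  apply: ler_sum => y yx; rewrite exprMn ler_wpM2l ?sqr_ge0//.
  rewrite ler_sqr ?nnegrE; first by rewrite overlap_ge// (inj_eq enum_val_inj) eq_sym.
    by rewrite !mulr_ge0.
  by apply: sumr_ge0 => i _; rewrite mulr_ge0// /amplitude; case: ifP.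
have : \sum_(x : 'I_#|F|) q^-1 ^+ 2 * (1 + (q - 1) * e) <= \sum_(x : 'I_#|F|)
    \sum_(y : 'I_#|F|) (q^-1 * overlap p (enum_val x) (enum_val y)) ^+ 2.
  by apply: ler_sum => x _; exact: row_ge.
apply: le_trans; rewrite sumr_const card_ord -[_ *+ _]mulr_natl eE.
rewrite le_eqVlt; apply/orP; left; apply/eqP; field; lra.
Qed.

(** The factor 4 in the purity excess absorbs the 1/4 of the entropy inequality; the factor ln 2
    turns bits into nats. *)
Lemma holevo_le (p : R) : 0 <= p <= 1 ->
  holevo F p * ln 2 <= ln q - p * (1 - p) / q.
Proof.
move=> p01.
have q0 : 0 <= q^-1 by rewrite invr_ge0.
have ln2 : ln 2 != 0 :> R by rewrite gt_eqF// ln_gt0// ltr1n.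
have rhoE : channel_avg F p
    = q^-1%:C *: (\sum_i channel_ket p i *m (channel_ket p i)^t*).
  by rewrite /channel_avg fmorphV rmorph_nat.
have [x x0 /=] := gram_spectrum R F #|F| q^-1 (@channel_ket R F p) q0.
rewrite -rhoE => -[tr1 tr2 SE].
have [t trt tge] := purity_channel_avg p p01.
have x1 : \sum_i x i = 1.
  by apply: complexI; rewrite -tr1 mxtrace_channel_avg.
have x2 : \sum_i x i ^+ 2 = t by apply: complexI; rewrite -tr2.
have := entropy_le_collision R #|F| x x0 x1; rewrite x2.
rewrite /holevo SE mulNr mulr_suml.
under [in X in _ -> X]eq_bigr do rewrite /log2 mulrA divfK//.
lra.
Qed.

End Channel.

(** * Counting nonzero entries, the semicircle law, and the conclusion *)

Lemma regular_double_count (F : finFieldType) (k r m n D : nat)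
    (I : linsat F k r m n) : linsat_regular D I -> (k * m = D * n)%N.
Proof.
move=> reg.
have row_sum i : (\sum_(j < n) (linsat_mx I i j != 0%R) = k)%N.
  by rewrite -[RHS](linsat_row I i) -sum1_card [RHS]big_mkcond;
    apply: eq_bigr => j _; rewrite inE; case: (_ == _).
have col_sum j : (\sum_(i < m) (linsat_mx I i j != 0%R) = D)%N.
  by rewrite -[RHS](reg j) -sum1_card [RHS]big_mkcond;
    apply: eq_bigr => i _; rewrite inE; case: (_ == _).
have : (\sum_(i < m) \sum_(j < n) (linsat_mx I i j != 0%R) = k * m)%N.
  by rewrite (eq_bigr _ (fun i _ => row_sum i)) sum_nat_const card_ord mulnC.
rewrite exchange_big (eq_bigr _ (fun j _ => col_sum j)).
by rewrite sum_nat_const card_ord mulnC.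
Qed.

(** With s = r/q and t = sqrt p, the expanded square is at most s + p + 2 t <= s + 3 t. In the
    saturated branch p > 1 - s >= 1/q, so q t >= q p >= 1 and the right-hand side already exceeds
    1. *)
Lemma alpha_DQI_le (R : realType) (q r : nat) (p : R) :
  (0 < r <= q.-1)%N -> 0 <= p <= 1 ->
  alpha_DQI q r p <= r%:R / q%:R + 3 * q%:R * Num.sqrt p.
Proof.
move=> /andP[r0 rq] /andP[p0 p1].
have q1 : (0 < q.-1)%N by exact: leq_trans rq.
have q0 : (0 < q)%N by case: q q1 {rq}.
have qR1 : 1 <= q%:R :> R by rewrite ler1n.
have rq1 : (r.+1 <= q)%N by rewrite -(prednK q0) ltnS.
have rR : 1 <= r%:R :> R by rewrite ler1n.
have rqR : r%:R + 1 <= q%:R :> R by rewrite natr1 ler_nat.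
set s : R := r%:R / q%:R.
have s0 : q%:R^-1 <= s by rewrite /s ler_peMl// invr_ge0; lra.
have qV0 : 0 < q%:R^-1 :> R by rewrite invr_gt0; lra.
have qqV : q%:R * q%:R^-1 = 1 :> R by rewrite mulfV//; lra.
have s1 : s <= 1 - q%:R^-1 by rewrite /s; nra.
have sge0 : 0 <= s by lra.
have pE := sqr_sqrtr p0; have t0 := sqrtr_ge0 p; set t := Num.sqrt p in pE t0 *.
have t1 : t <= 1 by rewrite -sqrtr1 ler_sqrt.
rewrite /alpha_DQI -/s; case: ifPn => [_|].
  have le_t : Num.sqrt (p * (1 - s)) <= t.
    by rewrite ler_sqrt//; nra.
  have le_1 : Num.sqrt (s * (1 - p)) <= 1.
    by rewrite -[leRHS]sqrtr1 ler_sqrt//; nra.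
  have a2 : Num.sqrt (p * (1 - s)) ^+ 2 = p * (1 - s).
    by rewrite sqr_sqrtr//; nra.
  have b2 : Num.sqrt (s * (1 - p)) ^+ 2 = s * (1 - p).
    by rewrite sqr_sqrtr//; nra.
  rewrite sqrrD a2 b2 -mulr_natr.
  have ab : Num.sqrt (p * (1 - s)) * Num.sqrt (s * (1 - p)) <= t * 1.
    by rewrite ler_pM ?sqrtr_ge0.
  have pt : p <= t by nra.
  nra.
rewrite -ltNge => sp.
have pV : q%:R^-1 <= p by lra.
have tp : p <= t by nra.
have : 1 <= q%:R * t by rewrite -[X in X <= _]qqV ler_wpM2l//; lra.
nra.
Qed.

Theorem mainTheorem5 (R : realType) (q r k : nat) (hr : (1 <= r <= q.-1)%N) :
  exists (C : R) (D0 : nat), forall D : nat, (D0 <= D)%N ->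
    forall (F : finFieldType) (hF : #|F| = q)
      (m n : nat) (hm : (0 < m)%N)
      (I : linsat F k r m n) (hI : linsat_regular D I) (l : R),
      let p := l / m%:R in
      0 <= p <= 1 - q%:R^-1 ->
      (1 - n%:R / m%:R) * log2 q%:R <= holevo F p ->
      alpha_DQI q r p <= r%:R / q%:R + C / Num.sqrt D%:R.
Proof.
(* The constant comes from inserting p <= k q^2 ln q / D, established below, into the bound 3 q sqrt
   p; D >= 1 makes the divisions by D legitimate. *)
exists (3 * q%:R * Num.sqrt (k%:R * q%:R ^+ 2 * ln q%:R)), 1%N.
move=> D D1 F hF m n hm I hI l p /andP[p0 p1] rate.
have q1 : (1 < q)%N by rewrite -hF card_finNzRing_gt1.
have qR1 : 1 < q%:R :> R by rewrite ltr1n.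
have qV0 : 0 < q%:R^-1 :> R by rewrite invr_gt0; lra.
have p01 : 0 <= p <= 1 by apply/andP; split=> //; lra.
apply: le_trans (alpha_DQI_le R q r p hr p01) _.
rewrite lerD2l -!mulrA; do 2 rewrite ler_wpM2l//.
have D0 : 0 < D%:R :> R by rewrite ltr0n.
have m0 : 0 < m%:R :> R by rewrite ltr0n.
have lnq : 0 < ln q%:R :> R by rewrite ln_gt0.
have ln2 : 0 < ln 2 :> R by rewrite ln_gt0// ltr1n.
rewrite -sqrtrV ?(ltW D0)// -sqrtrM; last by rewrite !mulr_ge0// ltW.
rewrite ler_sqrt; last by rewrite !mulr_ge0// ?invr_ge0// ltW.
have nm : n%:R / m%:R = k%:R / D%:R :> R.
  apply/eqP; rewrite eqr_div ?lt0r_neq0// -!natrM eqr_nat mulnC.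
  by rewrite (regular_double_count _ _ _ _ _ _ _ hI).
have := holevo_le R F p p01; rewrite hF => hol.
have := rate; rewrite -(ler_pM2r ln2) /log2 -mulrA divfK ?gt_eqF// nm => rate'.
(* The rate condition in nats reads (1 - k/D) ln q <= ln q - p (1 - p) / q, and ln q cancels. *)
have key : p * (1 - p) / q%:R <= k%:R / D%:R * ln q%:R by lra.
(* The hypothesis p <= 1 - 1/q gives 1 - p >= 1/q, which excludes the other root region near p = 1
   and leaves a bound linear in p. *)
have pq : p * q%:R^-1 / q%:R <= k%:R / D%:R * ln q%:R.
  apply: le_trans key; rewrite ler_pM2r// ler_wpM2l//; lra.
have pX : p <= k%:R / D%:R * ln q%:R * q%:R ^+ 2.
  by rewrite -ler_pdivrMr ?exprn_gt0 ?(lt_trans ltr01)// expr2 invfM mulrA.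
by apply: le_trans pX _; rewrite le_eqVlt; apply/orP; left; apply/eqP; ring.
Qed.
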